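(* Every fence is embeddable into $\mathbb R^2$; that is, every fence is homeomorphic to a subspace of $\mathbb R^2$.
   Context: An arc is a space homeomorphic to $[0,1]$. A fence is a compact metric space each of whose connected components is either an arc or a singleton. *)

(* Defs.v *)
From HB Require Import structures.
From mathcomp Require Import all_boot all_order all_algebra.
From mathcomp Require Import all_classical all_reals all_analysis.

Set Implicit Arguments.
Unset Strict Implicit.
Unset Printing Implicit Defensive.

Import Order.TTheory GRing.Theory Num.Theory.
Import numFieldNormedType.Exports.

Local Open Scope classical_set_scope.
Local Open Scope ring_scope.

Definition homeomorphic (X Y : topologicalType) : Prop :=
  exists (f : X -> Y) (g : Y -> X),
    [/\ cancel f g, cancel g f, continuous f & continuous g].

(* [set_type A] is the subtype of points of [A], with the topology induced by
   the inclusion. *)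
Definition embeddable (X Y : topologicalType) : Prop :=
  exists A : set Y, homeomorphic X (set_type A).

Definition is_arc (R : realType) (X : topologicalType) : Prop :=
  homeomorphic X (set_type (`[0, 1] : set R)).

(* [metricType] does not require a point, so the empty space is a fence. *)
Definition is_fence (R : realType) (X : metricType R) : Prop :=
  compact [set: X] /\
  forall x : X,
    is_arc R (set_type (connected_component [set: X] x)) \/
    exists y : X, connected_component [set: X] x = [set y].

(* Main.v *)
Require Import Defs.
From mathcomp Require Import all_boot all_order all_algebra.
From mathcomp Require Import all_classical all_reals all_analysis.
From mathcomp Require Import lra.
Import numFieldNormedType.Exports.

Set Implicit Arguments.
Unset Strict Implicit.
Unset Printing Implicit Defensive.

Import Order.TTheory GRing.Theory Num.Theory.

Local Open Scope classical_set_scope.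
Local Open Scope ring_scope.

(** A compact metric space X embeds in the plane as soon as, for every e > 0,
it has a continuous map to the line whose fibres have diameter less than e; a
fence has such maps.

Why a fence has them. Each component K of X carries an injective continuous
function to the line (an arc coordinate, or a constant), which extends to all
of X by Tietze's theorem. In a compact Hausdorff space K is the intersection of
the clopen sets that contain it (quasicomponent_sub), so by compactness the
extension still has fibres of diameter less than e on some clopen neighbourhood
of K (local_small_fibres). Finitely many such neighbourhoods cover X; after
translation their images in the line are disjoint, and the pieces are glued
into a single map (fence_small_fibres).

Why such maps suffice. This is the argument that embeds inverse limits of arcs
in the plane. Consider the maps h = G o (psi, 0), where psi : X -> R is
continuous and G is a continuous injection of the plane into itself. Such an h
can be perturbed, inside the same class, into a map h' with small fibres
(refine_fibres). Indeed let phi : X -> R have very small fibres. Then psi is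
nearly a function of phi, say psi ~ f o phi (lipschitz_factorisation). The line
may be folded by f, but its graph t |-> (f t, d t) is an embedded curve, and it
lies near the axis if d is small; moreover it is the image of the axis under
the injection (t, s) |-> (f t + s, d t). Composing G with that injection gives
h'. Iterating with errors that decrease fast enough, the limit keeps the
separation achieved at every stage, hence is injective (embedding_limit). *)

(** * Moduli from compactness *)

Lemma continuous_dist (R : realType) (X : topologicalType)
    (V : normedModType R) (h : X -> V) :
  continuous h -> continuous (fun p : X * X => `|h p.1 - h p.2|).
Proof.
move=> ch p.
apply: (@continuous_comp _ _ _ (fun p : X * X => h p.1 - h p.2)); last first.
  exact: norm_continuous.
apply: continuousB.
  by apply: (@continuous_comp _ _ _ fst); [exact: cvg_fst|exact: ch].
by apply: (@continuous_comp _ _ _ snd); [exact: cvg_snd|exact: ch].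
Qed.

(** A condition valid on the fibres of h remains valid, by compactness, on pairs
of points with sufficiently close images. All quantitative injectivity below
comes from this lemma. *)
Lemma compact_fibre_modulus (R : realType) (X : topologicalType)
    (V : normedModType R) (h : X -> V) (O : set (X * X)) :
  compact [set: X] -> continuous h -> open O ->
  (forall x y, h x = h y -> O (x, y)) ->
  exists2 g : R, 0 < g & forall x y, `|h x - h y| < g -> O (x, y).
Proof.
move=> cX ch oO hO.
have cXX : compact [set: X * X] by rewrite -setXTT; exact: compact_setX.
have /compact_near_coveringP/(_ R (0^'+)
    (fun g p => `|h p.1 - h p.2| < g -> O p) _) := cXX.
case=> [[x y] _|e /= e0 He].
  have [hxy|hxy] := eqVneq (h x) (h y).
    exists (O, setT); first by split; [exact/open_nbhs_nbhs/(conj oO)/hO|exact: filterT].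
    by move=> [p g] /= [].
  have c0 : 0 < `|h x - h y| / 2 by rewrite divr_gt0// normr_gt0 subr_eq0.
  exists ([set p | `|h x - h y| / 2 < `|h p.1 - h p.2|],
            [set g | g < `|h x - h y| / 2]).
    split => /=; last exact: nbhs_right_lt.
    have := @continuous_dist _ _ _ _ ch (x, y).
    move/cvgr_gt; apply => /=; lra.
  by move=> [p g] /= [a b] c; have := lt_trans (lt_trans a c) b; rewrite ltxx.
exists (e / 2); first by rewrite divr_gt0.
move=> x y hxy; apply: (He (e / 2) _ _ (x, y)) => //=; last by rewrite divr_gt0.
by rewrite sub0r normrN gtr0_norm ?divr_gt0//; lra.
Qed.

Lemma compact_uniform_modulus (R : realType) (X : metricType R) (psi : X -> R) (t : R) :
  compact [set: X] -> continuous psi -> 0 < t ->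
  exists2 c : R, 0 < c & forall x y, mdist x y < c -> `|psi x - psi y| < t.
Proof.
move=> cX cpsi t0.
have /compact_near_coveringP/(_ R (0^'+) (fun c x => forall y,
    mdist x y < c -> `|psi x - psi y| < t) _) := cX.
case=> [x _|e /= e0 He]; last first.
  exists (e / 2) => [|x]; first by rewrite divr_gt0.
  apply: (He (e / 2)) => //=; last by rewrite divr_gt0.
  by rewrite sub0r normrN gtr0_norm ?divr_gt0//; lra.
have t2 : 0 < t / 2 by rewrite divr_gt0.
have /cvgrPdist_lt/(_ _ t2)/nbhs_ballP[r /= r0 hr] := cpsi x.
have r2 : 0 < r / 2 by rewrite divr_gt0.
exists (ball x (r / 2), [set c | c < r / 2]) => /=.
  by split; [exact: nbhsx_ballx|exact: nbhs_right_lt].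
move=> [x' c] /=; rewrite ballEmdist /= => -[xx' cr] y x'y.
have h1 : `|psi x - psi x'| < t / 2 by apply: hr; rewrite ballEmdist /=; lra.
have h2 : `|psi x - psi y| < t / 2.
  by apply: hr; rewrite ballEmdist /=; have := metric_triangle x x' y; lra.
by move: h1 h2; rewrite !ltr_norml; lra.
Qed.

Lemma open_mdist_lt (R : realType) (X : metricType R) (e : R) :
  open [set p : X * X | mdist p.1 p.2 < e].
Proof.
rewrite openE => -[x y] /= xye.
have r0 : 0 < (e - mdist x y) / 2 by rewrite divr_gt0// subr_gt0.
exists (ball x ((e - mdist x y) / 2), ball y ((e - mdist x y) / 2)) => /=.
  by split; exact: nbhsx_ballx.
move=> [a b] /=; rewrite !ballEmdist /= (metric_sym x a) => -[xa yb].
have := metric_triangle a x b; have := metric_triangle x y b; lra.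
Qed.

Lemma continuous_bounded (R : realType) (X : topologicalType) (f : X -> R) :
  compact [set: X] -> continuous f ->
  exists2 M : R, 0 < M & forall x, `|f x| <= M.
Proof.
move=> cX cf.
have /compact_bounded [M [_ hM]] : compact (range f).
  by apply: continuous_compact => //; exact: continuous_subspaceT.
exists (`|M| + 1); first by rewrite ltr_wpDl.
by move=> x; apply: (hM (`|M| + 1)) => //; rewrite (le_lt_trans (ler_norm _))// ltrDl.
Qed.

(** * Components and clopen sets *)

Definition quasicomponent (X : topologicalType) (x : X) : set X :=
  \bigcap_(D in [set D | clopen D /\ D x]) D.

(** The filter of sets of sets that makes sense of a property holding for all
sufficiently small clopen neighbourhoods of x. *)
Definition clopen_small (X : topologicalType) (x : X) : set_system (set X) :=
  filter_from [set D : set X | clopen D /\ D x] (fun D => [set E | E `<=` D]).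

Lemma clopen_small_filter (X : topologicalType) (x : X) :
  Filter (clopen_small x).
Proof.
apply: filter_from_filter; first by exists setT; split => //; exact: clopenT.
move=> D E [cD Dx] [cE Ex]; exists (D `&` E).
  by split; [exact: clopenI|split].
by move=> W WDE; split=> w /WDE [].
Qed.

(** Compactness of Y makes a locally uniform choice of clopen neighbourhood of x
global. *)
Lemma clopen_near_covering (X Y : topologicalType) (x : X) (P : set X -> Y -> Prop) :
  compact [set: Y] ->
  (forall y : Y, \forall y' \near y & E \near clopen_small x, P E y') ->
  exists D, [/\ clopen D, D x & forall y, P D y].
Proof.
move=> cY hP.
have /compact_near_coveringP/(_ _ _ P (clopen_small_filter x)) := cY.
case=> [y _|D [cD Dx] h]; first exact: hP.
by exists D; split => // y; apply: (h D).
Qed.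

(** A point outside the quasicomponent is excluded, together with a
neighbourhood, from all small enough clopen sets around x; in the covering
arguments below only points of the quasicomponent then need attention. *)
Lemma quasicomponent_near (X : topologicalType) (x y : X) :
  ~ quasicomponent x y ->
  \forall y' \near y & E \near clopen_small x, ~ E y'.
Proof.
move=> /existsNP [D /not_implyP[[[oD cD] Dx] Dy]].
exists (~` D, [set E | E `<=` D]) => /=.
  split; last by exists D.
  by apply: open_nbhs_nbhs; split => //; exact: closed_openC.
by move=> [z E] /= [Dz ED] /ED.
Qed.

Lemma quasicomponent_closed (X : topologicalType) (x : X) :
  closed (quasicomponent x).
Proof. by apply: closed_bigI => D [[]]. Qed.

(** Separate the two parts of a splitting of the quasicomponent by disjoint open
sets U and V. By compactness some clopen D around x lies in the union of U and
V, so D meets each of them in a clopen set, and the quasicomponent must lie in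
the one that contains x. *)
Lemma quasicomponent_connected (R : realType) (X : topologicalType) (x : X) :
  hausdorff_space X -> compact [set: X] -> connected (quasicomponent x).
Proof.
move=> hX cX B B0 [C oC BC] [C' cC' BC'].
have cB : closed B by rewrite BC'; apply: closedI => //; exact: quasicomponent_closed.
have cB' : closed (quasicomponent x `\` C).
  by apply: closedI; [exact: quasicomponent_closed|exact: open_closedC].
have BB' : B `&` (quasicomponent x `\` C) = set0.
  by rewrite BC -subset0 => y /= [[_ ?] []].
have /(@normal_openP R)/(_ _ _ cB cB' BB') [U [V [oU oV BU BV UV]]] :=
  compact_normal hX cX.
have [|D [[oD cD] Dx DUV]] := @clopen_near_covering X X x (fun E y => E y -> (U `|` V) y) cX.
  move=> y; have [Qy|nQy] := pselect (quasicomponent x y); last first.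
    have [AB hAB sAB] := quasicomponent_near nQy.
    by exists AB => // -[z E] /sAB.
  exists (U `|` V, setT); last by move=> [z E] /= [].
  split; last exact: (@filterT _ _ (clopen_small_filter x)).
  apply: open_nbhs_nbhs; split; first exact: openU.
  have [Cy|Cy] := pselect (C y); [left; apply: BU|right; apply: BV] => //.
  by rewrite BC.
have clp W W' : open W -> open W' -> (forall y, D y -> (W `|` W') y) ->
    W `&` W' = set0 -> clopen (D `&` W).
  move=> oW oW' DW WW; split; first exact: openI.
  have -> : D `&` W = D `&` ~` W'.
    apply/seteqP; split => y [Dy]; first by move=> Wy; split => // Wy'; rewrite -[False]/(set0 y) -WW.
    by move=> Wy'; split => //; have [] := DW y Dy.
  by apply: closedI => //; exact: open_closedC.
have [Ux|Vx] := DUV x Dx.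
  apply/seteqP; split; first by rewrite BC; exact: subIsetl.
  move=> y Qy; rewrite BC; split => //; apply: contrapT => Cy.
  have [|_ Uy] := Qy (D `&` U); first by split; [exact: (clp U V)|].
  by rewrite -[False]/(set0 y) -UV; split => //; exact: BV.
case: B0 => y By; have Qy : quasicomponent x y by move: By; rewrite BC => -[].
have [|_ Vy] := Qy (D `&` V).
  split; last by [].
  by apply: (clp V U) => //; [move=> z /DUV []; [right|left]|rewrite setIC].
by exfalso; rewrite -[False]/(set0 y) -UV; split => //; exact: BU.
Qed.

Lemma quasicomponent_sub (R : realType) (X : topologicalType) (x : X) :
  hausdorff_space X -> compact [set: X] ->
  quasicomponent x `<=` connected_component [set: X] x.
Proof.
move=> hX cX; apply: connected_component_max => //; first by move=> D [].
exact: (quasicomponent_connected R).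
Qed.

(** The pairs of points at distance at least e with equal images form a compact
set that misses the square of the component, hence also misses the square of a
small clopen neighbourhood. *)
Lemma local_small_fibres (R : realType) (X : metricType R) (x : X) (psi : X -> R) (e : R) :
  compact [set: X] -> 0 < e -> continuous psi ->
  {in connected_component [set: X] x &, injective psi} ->
  exists D : set X, [/\ clopen D, D x &
    forall y z, D y -> D z -> psi y = psi z -> mdist y z < e].
Proof.
move=> cX e0 cpsi ipsi.
have hX : hausdorff_space X by exact: metric_hausdorff.
have cXX : compact [set: X * X] by rewrite -setXTT; exact: compact_setX.
have [|D [cD Dx hD]] := @clopen_near_covering X (X * X)%type x
    (fun E p => E p.1 -> E p.2 -> psi p.1 = psi p.2 -> mdist p.1 p.2 < e) cXX; last first.
  by exists D; split => // y z Dy Dz; exact: (hD (y, z)).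
move=> [y z]; have sub := @quasicomponent_sub R X x hX cX.
have FF := clopen_small_filter x.
have [Qy|nQy] := pselect (quasicomponent x y); last first.
  have [[A B] /= [Ay FB] AB] := quasicomponent_near nQy.
  exists (A `*` setT, B) => /=.
    split => //; exists (A, setT) => //=; split => //; exact: filterT.
  by move=> [[a b] E] /= [[Aa _] BE] /(AB (a, E) (conj Aa BE)).
have [Qz|nQz] := pselect (quasicomponent x z); last first.
  have [[A B] /= [Ay FB] AB] := quasicomponent_near nQz.
  exists (setT `*` A, B) => /=.
    split => //; exists (setT, A) => //=; split => //; exact: filterT.
  by move=> [[a b] E] /= [[_ Aa] BE] _ /(AB (b, E) (conj Aa BE)).
have [pyz|pyz] := eqVneq (psi y) (psi z).
  have {pyz}yz : y = z by apply: ipsi => //; rewrite inE; exact: sub.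
  subst z.
  exists (ball y (e / 2) `*` ball y (e / 2), setT).
    split; last exact: filterT.
    by exists (ball y (e / 2), ball y (e / 2)) => //=; split; apply: nbhsx_ballx; rewrite divr_gt0.
  move=> [[a b] E] /= [[ya yb] _] _ _ _.
  have := ball_triangle (ball_sym ya) yb.
  by rewrite -splitr ballEmdist.
have c0 : 0 < `|psi y - psi z| by rewrite normr_gt0 subr_eq0.
exists ([set p | 0 < `|psi p.1 - psi p.2|], setT).
  split; last exact: filterT.
  by have /cvgr_gt := @continuous_dist _ _ _ _ cpsi (y, z); apply.
by move=> [[a b] E] /= [ab _] _ _ abE; move: ab; rewrite abE subrr normr0 ltxx.
Qed.

(** * Maps of a fence to the line with small fibres *)

Lemma arc_coordinate (R : realType) (X : topologicalType) (K : set X) :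
  normal_space X -> closed K -> is_arc R (set_type K) ->
  exists2 psi : X -> R, continuous psi & {in K &, injective psi}.
Proof.
move=> nX cK [f [g [fg gf cf cg]]].
pose k : K -> R := set_val \o f.
have ck : continuous k.
  move=> a; apply: (@continuous_comp _ _ _ f); first exact: cf.
  exact: initial_continuous.
pose k' : X -> R^o := valL_ 0 k.
have k'E x (Kx : x \in K) : k' x = k (exist _ x Kx).
  by rewrite -[in RHS](valLK 0 k).
have ck' : {within K, continuous k'} by apply/subspace_valL_continuousP'.
have [||psi [psik cpsi _]] := continuous_bounded_extension nX cK _ ck' (M := 1).
- exact: ltr01.
- move=> x Kx; rewrite (k'E x (mem_set Kx)) /k /=.
  case: (f _) => t tI /=; have := set_mem tI; rewrite /= in_itv/= => /andP[t0 t1].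
  by rewrite ger0_norm.
exists psi => // x y Kx Ky; rewrite -!psik// !k'E /k /=.
by move=> /val_inj/(can_inj fg)[].
Qed.

Lemma fence_local_coordinate (R : realType) (X : metricType R) (x : X) :
  is_fence X -> exists2 psi : X -> R, continuous psi &
    {in connected_component [set: X] x &, injective psi}.
Proof.
move=> [cX /(_ x) [arcK|[y ->]]]; last first.
  exists (fun=> 0) => //; first exact: cst_continuous.
  by move=> a b; rewrite !inE => -> ->.
apply: arc_coordinate => //; first exact: compact_normal (@metric_hausdorff _ _) cX.
by apply: component_closed; exact: closedT.
Qed.

Lemma clopen_patch_continuous (X Y : topologicalType) (D : set X) (f g : X -> Y) :
  clopen D -> continuous f -> continuous g ->
  continuous (fun x => if x \in D then f x else g x).
Proof.
move=> [oD cD] cf cg x; have [Dx|Dx] := boolP (x \in D).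
  rewrite /continuous_at Dx; apply: cvg_trans (cf x); apply: near_eq_cvg.
  have : nbhs x D by apply: open_nbhs_nbhs; split => //; exact/set_mem.
  by apply: filterS => z /mem_set ->.
rewrite /continuous_at (negbTE Dx); apply: cvg_trans (cg x); apply: near_eq_cvg.
have : nbhs x (~` D).
  by apply: open_nbhs_nbhs; split; [exact: closed_openC|by move=> /mem_set Dx'; rewrite Dx' in Dx].
by apply: filterS => z /mem_set; rewrite in_setC => /negbTE ->.
Qed.

Definition small_fibres_on (R : realType) (X : metricType R) (e : R) (W : set X) :=
  clopen W /\ exists2 psi : X -> R, continuous psi &
    forall y z, W y -> W z -> psi y = psi z -> mdist y z < e.

Lemma small_fibres_on_setU (R : realType) (X : metricType R) (e : R) (V W : set X) :
  compact [set: X] ->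
  small_fibres_on e V -> small_fibres_on e W -> small_fibres_on e (V `|` W).
Proof.
move=> cX [cV [f cf hf]] [cW [g cg hg]]; split; first exact: clopenU.
have [M M0 hM] := continuous_bounded cX cf.
have [N N0 hN] := continuous_bounded cX cg.
(* the shift makes the images of the two pieces disjoint *)
exists (fun x => if x \in V then f x else g x + (M + N + 1)).
  apply: clopen_patch_continuous => // x.
  by apply: cvgD; [exact: cg|exact: cvg_cst].
have dis a b : f a = g b + (M + N + 1) -> False.
  by have := hM a; have := hN b; rewrite !ler_norml; lra.
move=> y z Vy Vz; have [Vy'|Vy'] := boolP (y \in V); have [Vz'|Vz'] := boolP (z \in V).
- by apply: hf; exact/set_mem.
- by move/dis.
- by move/esym/dis.
- move/addIr; apply: hg.
  + by case: Vy => // /mem_set; rewrite (negbTE Vy').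
  + by case: Vz => // /mem_set; rewrite (negbTE Vz').
Qed.

(** The clopen sets with this property are stable under union, and every point
has one as a neighbourhood, so compactness gives the whole space. *)
Lemma fence_small_fibres (R : realType) (X : metricType R) (e : R) :
  is_fence X -> 0 < e -> exists2 psi : X -> R, continuous psi &
    forall y z, psi y = psi z -> mdist y z < e.
Proof.
move=> fX e0; have cX := fX.1.
pose F : set_system (set X) := filter_from (small_fibres_on e) (fun V => [set W | V `<=` W]).
have FF : Filter F.
  apply: filter_from_filter.
    exists set0; split; first exact: clopen0.
    by exists (fun=> 0) => //; exact: cst_continuous.
  move=> V W hV hW; exists (V `|` W); first exact: small_fibres_on_setU.
  by move=> U UVW; split => a ha; apply: UVW; [left|right].
have /compact_near_coveringP/(_ _ F (fun W x => W x) FF) := cX.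
case=> [x _|W [cW [psi cpsi hpsi]] hW].
  have [psi cpsi ipsi] := fence_local_coordinate x fX.
  have [D [cD Dx hD]] := local_small_fibres cX e0 cpsi ipsi.
  exists (D, [set W | D `<=` W]) => /=.
    split; first by apply: open_nbhs_nbhs; split => //; case: cD.
    by exists D => //; split => //; exists psi.
  by move=> [y W] /= [Dy]; exact.
by exists psi => // y z; apply: hpsi; exact: (hW W).
Qed.

(** * Approximate factorisation through the line *)

(** McShane's extension formula f s = sup_x (psi x - L |s - phi x|) defines an
L-Lipschitz function on the whole line even though psi is not a function of
phi. At s = phi y, the term of y gives psi y <= f s; with L = 2 M / g the points
x whose image is at distance at least g from s are too heavily penalised to
exceed this value, and at the others psi is less than psi y + t. *)
Lemma lipschitz_factorisation (R : realType) (X : Type) (psi phi : X -> R) (M t g : R) :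
  0 < g -> 0 < t -> (forall x, `|psi x| <= M) ->
  (forall x y, `|phi x - phi y| < g -> `|psi x - psi y| < t) ->
  exists2 f : R -> R, continuous f & forall x, `|f (phi x) - psi x| <= t.
Proof.
move=> g0 t0 hM hg; have [X0|X0] := pselect (exists x : X, True); last first.
  by exists id => [x|x]; [exact: cvg_id|case: X0; exists x].
have [x0 _] := X0.
have M0 : 0 <= M by exact: le_trans (hM x0).
pose L : R := 2 * M / g.
have L0 : 0 <= L by rewrite divr_ge0 ?mulr_ge0// ltW.
pose E s : set R := range (fun x => psi x - L * `|s - phi x|).
have ubE s : ubound (E s) M.
  move=> _ [x _ <-]; have := hM x; rewrite ler_norml => /andP[_ h].
  by rewrite lerBlDr (le_trans h)// lerDl mulr_ge0.
have hE s : has_sup (E s).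
  by split; [exists (psi x0 - L * `|s - phi x0|); exists x0|exists M; exact: ubE].
pose f s := sup (E s).
have fge s x : psi x - L * `|s - phi x| <= f s.
  by apply: ub_le_sup; [exists M; exact: ubE|exists x].
have fle s c : (forall x, psi x - L * `|s - phi x| <= c) -> f s <= c.
  move=> h; apply: ge_sup; first by exists (psi x0 - L * `|s - phi x0|); exists x0.
  by move=> _ [x _ <-].
have lip s s' : f s <= f s' + L * `|s - s'|.
  apply: fle => x; rewrite -lerBlDr; apply: le_trans (fge s' x).
  rewrite -addrA lerD2l -opprD lerN2 -mulrDr ler_wpM2l//.
  by rewrite [leRHS]addrC (distrC s s') ler_distD.
have lipN s s' : `|f s - f s'| <= L * `|s - s'|.
  by rewrite ler_norml; have := lip s s'; have := lip s' s; rewrite (distrC s'); lra.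
exists f.
  move=> s; apply/cvgrPdist_lt => e e0.
  have L1 : 0 < L + 1 by lra.
  have d0 : 0 < e / (L + 1) by rewrite divr_gt0.
  near=> s'.
  have : `|s - s'| < e / (L + 1) by near: s'; exact: cvgr_dist_lt.
  rewrite ltr_pdivlMr// => h; apply: le_lt_trans (lipN _ _) _; apply: le_lt_trans h.
  by rewrite mulrC ler_wpM2l//; lra.
move=> x; rewrite ger0_norm; last first.
  by have := fge (phi x) x; rewrite subrr normr0 mulr0 subr0 subr_ge0.
rewrite lerBlDr; apply: fle => y.
have [lt_g|ge_g] := ltP `|phi x - phi y| g.
  have h := hg _ _ lt_g; have : 0 <= L * `|phi x - phi y| by rewrite mulr_ge0.
  by move: h; rewrite ltr_norml; lra.
have : L * g <= L * `|phi x - phi y| by rewrite ler_wpM2l.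
rewrite /L divfK ?gt_eqF//.
by have := hM x; have := hM y; rewrite !ler_norml; lra.
Unshelve. all: end_near. Qed.

(** * Unfolding in the plane *)

Lemma pair_continuous (X Y Z : topologicalType) (f : X -> Y) (g : X -> Z) :
  continuous f -> continuous g -> continuous (fun x => (f x, g x)).
Proof. by move=> cf cg x; apply: cvg_pair; [exact: cf|exact: cg]. Qed.

(** The plane maps G are only asked to be injective: this is enough for the
fibres of h to be those of psi. *)
Definition factors_through_line (R : realType) (X : topologicalType)
    (h : X -> R * R) :=
  exists (G : R * R -> R * R) (psi : X -> R),
    [/\ continuous G, injective G, continuous psi &
        forall x, h x = G (psi x, 0)].

Lemma factors_through_line_continuous (R : realType) (X : topologicalType)
  (h : X -> R * R) : factors_through_line h -> continuous h.
Proof.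
move=> [G [psi [cG _ cpsi hE]]]; rewrite (funext hE) => x.
apply: (@continuous_comp _ _ _ (fun x => (psi x, 0))); last exact: cG.
by apply: pair_continuous => //; exact: cst_continuous.
Qed.

(** Bounds the error allowed in the plane coordinates of a perturbation when G is
not uniformly continuous on the whole plane. *)
Lemma line_neighbourhood_modulus (R : realType) (X : topologicalType)
    (G : R * R -> R * R) (psi : X -> R) (t : R) :
  compact [set: X] -> continuous G -> continuous psi -> 0 < t ->
  exists2 s : R, 0 < s & forall x a b, `|a - psi x| < s -> `|b| < s ->
    `|G (a, b) - G (psi x, 0)| < t.
Proof.
move=> cX cG cpsi t0.
have /compact_near_coveringP/(_ R (0^'+) (fun s x => forall a b,
    `|a - psi x| < s -> `|b| < s -> `|G (a, b) - G (psi x, 0)| < t) _) := cX.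
case=> [x _|e /= e0 He]; last first.
  exists (e / 2) => [|x]; first by rewrite divr_gt0.
  apply: (He (e / 2)) => //=; last by rewrite divr_gt0.
  by rewrite sub0r normrN gtr0_norm ?divr_gt0//; lra.
have t2 : 0 < t / 2 by rewrite divr_gt0.
have /cvgrPdist_lt/(_ _ t2)/nbhs_ballP[r /= r0 hr] := cG (psi x, 0).
have r2 : 0 < r / 2 by rewrite divr_gt0.
exists ([set x' | `|psi x - psi x'| < r / 2], [set s | s < r / 2]) => /=.
  split; last exact: nbhs_right_lt.
  by have /cvgrPdist_lt/(_ _ r2) := cpsi x.
move=> [x' s] /= [xx' sr] a b ha hb.
have h1 : `|G (psi x, 0) - G (a, b)| < t / 2.
  apply: hr; split; rewrite /= /ball/= ?sub0r ?normrN; last by lra.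
  by move: xx' ha; rewrite !ltr_norml; lra.
have h2 : `|G (psi x, 0) - G (psi x', 0)| < t / 2.
  by apply: hr; split; rewrite /= /ball/= ?subrr ?normr0//; lra.
rewrite (splitr t) (le_lt_trans (ler_distD (G (psi x, 0)) _ _))//.
by rewrite ltrD// distrC.
Qed.

Lemma shear_continuous (R : realType) (f : R -> R) (d : R) :
  continuous f -> continuous (fun p : R * R => (f p.1 + p.2, d * p.1)).
Proof.
move=> cf; apply: pair_continuous => p.
  apply: cvgD; last exact: cvg_snd.
  by apply: (@continuous_comp _ _ _ fst f); [exact: cvg_fst|exact: cf].
by apply: cvgM; [exact: cvg_cst|exact: cvg_fst].
Qed.

(** The second coordinate determines the first argument, and then the first
coordinate determines the second, however much f folds the line. *)
Lemma shear_injective (R : realType) (f : R -> R) (d : R) :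
  d != 0 -> injective (fun p : R * R => (f p.1 + p.2, d * p.1)).
Proof. by move=> d0 [a b] [a' b'] /= [+ /(mulfI d0) aa']; rewrite aa' => /addrI ->. Qed.

(** The heart of the construction: the fold of the line needed to approximate
psi by a function of phi is unfolded in the second dimension of the plane. *)
Lemma refine_fibres (R : realType) (X : metricType R) (h : X -> R * R) (e t : R) :
  compact [set: X] ->
  (forall e, 0 < e -> exists2 psi : X -> R, continuous psi &
    forall y z, psi y = psi z -> mdist y z < e) ->
  factors_through_line h -> 0 < e -> 0 < t ->
  exists h' : X -> R * R, [/\ factors_through_line h',
    forall x, `|h' x - h x| < t &
    forall x y, h' x = h' y -> mdist x y < e].
Proof.
move=> cX small [G [psi [cG iG cpsi hE]]] e0 t0.
have [s s0 hs] := line_neighbourhood_modulus cX cG cpsi t0.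
have s2 : 0 < s / 2 by rewrite divr_gt0.
have [c c0 hc] := compact_uniform_modulus cX cpsi s2.
have [|phi cphi hphi] := small (Num.min c e); first by rewrite lt_min c0.
have [||g g0 hg] := compact_fibre_modulus (h := phi)
    (O := [set p | `|psi p.1 - psi p.2| < s / 2]) cX cphi.
- rewrite openE => p /= hp.
  by have /cvgr_lt := @continuous_dist _ _ _ _ cpsi p; apply.
- by move=> x y /hphi; rewrite lt_min => /andP[/hc].
have [M M0 hM] := continuous_bounded cX cpsi.
have [N N0 hN] := continuous_bounded cX cphi.
have [f cf hf] := lipschitz_factorisation g0 s2 hM hg.
(* so that |d * phi x| < s for all x *)
pose d := s / (N + 1).
have N1 : 0 < N + 1 by lra.
have d0 : 0 < d by rewrite divr_gt0.
exists (fun x => G (f (phi x), d * phi x)); split.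
- exists (G \o (fun p => (f p.1 + p.2, d * p.1))), phi; split => //.
  + move=> p; apply: continuous_comp; last exact: cG.
    exact: shear_continuous.
  + by apply: inj_comp => //; apply: shear_injective; rewrite gt_eqF.
  + by move=> x /=; rewrite addr0.
- move=> x; rewrite hE; apply: hs; first by apply: le_lt_trans (hf x) _; lra.
  rewrite normrM (gtr0_norm d0) /d mulrAC ltr_pdivrMr// ltr_pM2l//.
  by rewrite (le_lt_trans (hN x))// ltrDl.
- move=> x y /iG[_ /(mulfI (lt0r_neq0 d0))] /hphi.
  by rewrite lt_min => /andP[].
Qed.

(** * Limits of perturbations *)

(** The intervals of centre u n and radius c n are nested, hence have a common
point, the supremum of their left ends. *)
Lemma telescoping_limit (R : realType) (u c : nat -> R) :
  (forall n, 0 <= c n) -> (forall n, `|u n.+1 - u n| <= c n - c n.+1) ->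
  exists l, forall n, `|l - u n| <= c n.
Proof.
move=> c0 uc.
have lo m n : (m <= n)%N -> u m - c m <= u n - c n.
  move=> /subnK <-; elim: (n - m)%N => [//|k IH]; rewrite addSn.
  by apply: le_trans IH _; have := uc (k + m)%N; rewrite ler_norml; lra.
have hi m n : (m <= n)%N -> u n + c n <= u m + c m.
  move=> /subnK <-; elim: (n - m)%N => [//|k IH]; rewrite addSn.
  by apply: le_trans _ IH; have := uc (k + m)%N; rewrite ler_norml; lra.
have lohi m n : u m - c m <= u n + c n.
  have [mn|/ltnW nm] := leqP m n.
    by have := lo _ _ mn; have := c0 n; lra.
  by have := hi _ _ nm; have := c0 m; lra.
exists (sup (range (fun n => u n - c n))) => n; rewrite ler_distl; apply/andP; split.
  apply: ub_le_sup; last by exists n.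
  by exists (u n + c n) => _ [m _ <-].
apply: ge_sup; first by exists (u n - c n), n.
by move=> _ [m _ <-].
Qed.

(** The errors g n / 8 add up to at most g n / 4 after stage n, so the limit k
stays within g n / 4 of h n and two points with images under k closer than
g n / 2 have images under h n closer than g n. *)
Lemma embedding_limit (R : realType) (X : metricType R)
    (h : nat -> X -> R * R) (g : nat -> R) :
  (forall n, continuous (h n)) -> (forall n, 0 < g n) ->
  (forall n, g n.+1 <= g n / 2) ->
  (forall n x, `|h n.+1 x - h n x| < g n / 8) ->
  (forall n x y, `|h n.+1 x - h n.+1 y| < g n.+1 -> mdist x y < g n) ->
  exists2 k : X -> R * R, continuous k & forall e, 0 < e ->
    exists2 r, 0 < r & forall x y, `|k x - k y| < r -> mdist x y < e.
Proof.
move=> ch g0 g2 hh hg.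
have lim (pr : R * R -> R) x : (forall p q, pr (p - q) = pr p - pr q) ->
    (forall p, `|pr p| <= `|p|) -> exists l, forall n, `|l - pr (h n x)| <= g n / 4.
  move=> prB pr1; apply: (@telescoping_limit R (fun n => pr (h n x))).
    by move=> n; rewrite divr_ge0// ltW.
  move=> n; rewrite -prB; apply: le_trans (pr1 _) _.
  by apply: le_trans (ltW (hh n x)) _; have := g2 n; lra.
have [k hk] : {k : X -> R * R & forall x n, `|k x - h n x| <= g n / 4}.
  apply: (choice (P := fun x (l : R * R) => forall n, `|l - h n x| <= g n / 4)) => x.
  have [|p|a ha] := lim fst x; [by []|by rewrite prod_normE le_max lexx|].
  have [|p|b hb] := lim snd x; [by []|by rewrite prod_normE le_max lexx orbT|].
  by exists (a, b) => n; rewrite prod_normE ge_max ha hb.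
have gsmall e : 0 < e -> exists n, g n < e.
  move=> e0; have gn n : g n <= g 0%N / 2 ^+ n.
    elim: n => [|n IH]; first by rewrite expr0 divr1.
    by rewrite exprSr invfM mulrA (le_trans (g2 n))// ler_pM2r// invr_gt0.
  have [n _ /(_ n (leqnn n)) hn] :=
    near_infty_natSinv_expn_lt (PosNum (divr_gt0 e0 (g0 0%N))).
  exists n; apply: le_lt_trans (gn n) _.
  by move: hn => /=; rewrite mul1r ltr_pdivlMr// mulrC.
exists k.
  move=> x; apply/cvgrPdist_lt => e e0; have [n gn] := gsmall e e0.
  have gn4 : 0 < e / 4 by rewrite divr_gt0.
  have := ch n x; move/cvgrPdist_lt/(_ _ gn4); apply: filterS => y hxy.
  have := ler_distD (h n x) (k x) (k y); have := ler_distD (h n y) (h n x) (k y).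
  have := hk x n; have := hk y n; rewrite (distrC (h n y) (k y)); lra.
move=> e e0; have [n gn] := gsmall e e0.
exists (g n.+1 / 2) => [|x y kxy]; first by rewrite divr_gt0.
apply: lt_trans gn; apply: hg.
have := ler_distD (k x) (h n.+1 x) (h n.+1 y); have := ler_distD (k y) (k x) (h n.+1 y).
have := hk x n.+1; have := hk y n.+1; rewrite (distrC (h n.+1 x) (k x)); have := g0 n.+1; lra.
Qed.

(** The hypothesis is continuity of the inverse, phrased without mentioning it;
it includes injectivity. *)
Lemma continuous_inverse_embeddable (R : realType) (X : metricType R) (Y : topologicalType)
    (k : X -> Y) :
  continuous k -> (forall x (e : R), 0 < e ->
    \forall y \near k x, forall z, k z = y -> mdist x z < e) ->
  embeddable X Y.
Proof.
move=> ck hk.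
have ik x y : k x = k y -> x = y.
  move=> kxy; apply: mdist_positivity; apply/eqP; rewrite eq_le mdist_ge0 andbT.
  by apply/ler_addgt0Pr => e e0; rewrite add0r; have /nbhs_singleton/(_ _ (esym kxy))/ltW := hk x e e0.
exists (range k).
pose f x : set_type (range k) := exist _ (k x) (mem_set (ex_intro2 _ _ x I erefl)).
have [g gK] : {g : set_type (range k) -> X & forall b, f (g b) = b}.
  apply: (choice (P := fun b x => f x = b)) => -[y yA].
  have [x _ xy] := set_mem yA.
  by exists x; apply: val_inj.
have fK : cancel f g by move=> x; apply: ik; have := gK (f x) => /(congr1 val).
exists f, g; split => //.
  by apply: continuous_comp_initial.
move=> b A /nbhs_ballP[e /= e0 eA].
have hn := hk (g b) e e0.
have kb : k (g b) = set_val b by rewrite -[in RHS](gK b).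
rewrite kb in hn.
have : nbhs b [set b' : set_type (range k) |
    forall z, k z = set_val b' -> mdist (g b) z < e].
  exact: (@initial_continuous _ _ set_val b _ hn).
apply: (@filterS _ _ (@nbhs_filter (set_type (range k)) b)) => b' /= hb'.
by apply: eA; rewrite ballEmdist /=; apply: hb'; rewrite -[in RHS](gK b').
Qed.

Theorem theorem4 (R : realType) (X : metricType R) :
  is_fence X -> embeddable X (R * R)%type.
Proof.
move=> fX; have cX := fX.1.
(* A state is a map together with its current modulus of separation; the
   modulus also serves as the fibre size required of the next map. *)
pose good (s : (X -> R * R) * R) := factors_through_line s.1 /\ 0 < s.2.
pose next (s s' : (X -> R * R) * R) := good s -> [/\ good s', s'.2 <= s.2 / 2,
  forall x, `|s'.1 x - s.1 x| < s.2 / 8 &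
  forall x y, `|s'.1 x - s'.1 y| < s'.2 -> mdist x y < s.2].
have nextP s : {s' | next s s'}.
  apply: cid; have [[Fs g0]|ngood] := pselect (good s); last by exists s => /ngood.
  have g8 : 0 < s.2 / 8 by rewrite divr_gt0.
  have [h' [Fh' hh' fib]] :=
    refine_fibres cX (fun e => fence_small_fibres fX (e := e)) Fs g0 g8.
  have [c c0 hc] := compact_fibre_modulus cX (factors_through_line_continuous Fh')
    (@open_mdist_lt R X s.2) fib.
  have g2 : 0 < s.2 / 2 by rewrite divr_gt0.
  exists (h', Num.min c (s.2 / 2)) => _; split => //=.
  - by split => //=; rewrite lt_min c0.
  - by rewrite ge_min lexx orbT.
  - by move=> x y; rewrite lt_min => /andP[/hc].
have good0 : good (fun=> (0, 0), 1).
  split => //=; exists id, (fun=> 0); split => //; last exact: cst_continuous.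
  by move=> x; exact: cvg_id.
have [S [S0 SS]] := dependent_choice nextP (fun=> (0, 0), 1).
have gS n : good (S n) by elim: n => [|n /SS[]//]; rewrite S0.
have [||||| k ck hk] := @embedding_limit R X (fun n => (S n).1) (fun n => (S n).2).
- by move=> n; apply: factors_through_line_continuous; case: (gS n).
- by move=> n; case: (gS n).
- by move=> n; case: (SS n (gS n)).
- by move=> n; case: (SS n (gS n)).
- by move=> n; case: (SS n (gS n)).
apply: (continuous_inverse_embeddable ck) => x e /hk[r r0 hr].
have /cvgrPdist_lt/(_ _ r0) : id @ k x --> k x by exact: cvg_id.
by apply: filterS => y hy z zy; apply: hr; rewrite zy.
Qed.
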